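(* Let $n\ge 1$ be an integer, let $\mathcal I$ be a nonempty finite indexing set and $\gamma:\mathcal I\to\mathbb Z_{>0}$. For $i\in\mathcal I$ and $j\in[\gamma(i)]$ let $I_{ij},J_{ij}\subseteq[n]$ with $|I_{ij}|=|J_{ij}|$, and let $\lambda_i\in\mathbb R$ for $i\in\mathcal I$. Then (1) implies (2): (1) For all $n\times n$ totally nonnegative matrices $A$, $$\sum_{i\in\mathcal I}\lambda_i\prod_{j=1}^{\gamma(i)}\det A\big(I_{ij}\big|J_{ij}\big)\ \ge\ 0.$$ (2) For all consecutive integers $u,v\in[n]$ and all $n\times n$ totally nonnegative matrices $A$, $$\sum_{i\in\mathcal I(u,v)}\lambda_i\prod_{j=1}^{\gamma(i)}\det A\big(I_{ij}(u,v)\big|J_{ij}\big)\ \ge\ 0.$$ The analogous result holds with columns in place of rows: (1) implies that for all consecutive $u,v\in[n]$ and all $n\times n$ totally nonnegative $A$, $\sum_{i\in\mathcal I'(u,v)}\lambda_i\prod_{j=1}^{\gamma(i)}\det A\big(I_{ij}\big|J_{ij}(u,v)\big)\ge 0$, where $\mathcal I'(u,v)$ is defined like $\mathcal I(u,v)$ but using the sets $J_{ij}$ in place of $I_{ij}$.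
   Context: $[n]=\{1,\dots,n\}$. Integers $u,v$ are consecutive if $|u-v|=1$. For $X\subseteq[n]$ and consecutive $u,v\in[n]$, $X(u,v):=(X\setminus\{u\})\cup\{v\}$ if $u\in X$ and $v\notin X$, and $X(u,v):=X$ otherwise. For $i\in\mathcal I$, $i(u,v):=\{j\in[\gamma(i)]:u\in I_{ij}\text{ and }v\notin I_{ij}\}$, and $\mathcal I(u,v):=\{i\in\mathcal I: |i(u,v)|=\max_{i'\in\mathcal I}|i'(u,v)|\}$. For the column version, $\mathcal I'(u,v)$ is obtained from the sets $\{j\in[\gamma(i)]:u\in J_{ij},\,v\notin J_{ij}\}$ in the same way. $A(X|Y)$ is the submatrix of $A$ with row indices in $X$ and column indices in $Y$ (increasing order); the empty determinant is $1$; empty sums are $0$ and empty products are $1$. A real matrix is totally nonnegative (TN) if the determinant of each of its square submatrices is $\ge 0$. *)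

(* Defs.v *)
From mathcomp Require Import all_boot all_order all_algebra.
From mathcomp Require Export reals.

Set Implicit Arguments.
Unset Strict Implicit.
Unset Printing Implicit Defensive.

Import Order.TTheory GRing.Theory Num.Theory.
Local Open Scope ring_scope.

(* The set [n] = {1, ..., n} is represented by 'I_n = {0, ..., n-1}. *)

Definition consecutive (u v : nat) : bool := `|u%:Z - v%:Z|%N == 1%N.

Section Minors.
Context {R : realType} {n : nat}.

(* On a set of ordinals, enum_val is the increasing enumeration. *)
Definition submatrix (A : 'M[R]_n) (X Y : {set 'I_n}) : 'M[R]_(#|X|, #|Y|) :=
  mxsub enum_val enum_val A.

(* When #|X| = #|Y|, conform_mx only transports submatrix A X Y to the type of
   square matrices; the value is meaningless when #|X| != #|Y|. *)
Definition minor (A : 'M[R]_n) (X Y : {set 'I_n}) : R :=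
  \det (conform_mx (0 : 'M[R]_#|X|) (submatrix A X Y)).

Definition totally_nonnegative (A : 'M[R]_n) : Prop :=
  forall X Y : {set 'I_n}, #|X| = #|Y| -> 0 <= minor A X Y.

End Minors.

Section Replacement.
Context {n : nat}.

(* The set usually written X(u,v). *)
Definition replace (X : {set 'I_n}) (u v : 'I_n) : {set 'I_n} :=
  if (u \in X) && (v \notin X) then v |: (X :\ u) else X.

Context {I : finType} {gamma : I -> nat}.

(* i(u,v), relative to the family S, which is that of the row sets or that of
   the column sets. *)
Definition replaced (S : forall i : I, 'I_(gamma i) -> {set 'I_n})
    (u v : 'I_n) (i : I) : {set 'I_(gamma i)} :=
  [set j | (u \in S i j) && (v \notin S i j)].

(* I(u,v) when S is the family of row sets, I'(u,v) when S is the family of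
   column sets *)
Definition max_replaced (S : forall i : I, 'I_(gamma i) -> {set 'I_n})
    (u v : 'I_n) : {set I} :=
  [set i | #|replaced S u v i| == \max_(i' : I) #|replaced S u v i'|].

End Replacement.

(* Main.v *)
Require Import Defs.
From mathcomp Require Import all_boot all_order all_algebra.
From mathcomp Require Import zify.
Import Order.TTheory GRing.Theory Num.Theory.
Local Open Scope ring_scope.

(** Adding t times row v to row u, for consecutive u and v and t >= 0, keeps a
    matrix totally nonnegative: the minor on (X, Y) gains t times the minor on
    (X(u,v), Y) when u is in X and v is not, and is unchanged otherwise. The
    left-hand side of (1) thus becomes a polynomial in t that is nonnegative on
    [0, +oo[; the sum in (2) is its coefficient in degree max_i |i(u,v)|, an
    upper bound of its degree, so it is nonnegative. Columns follow by
    transposition. *)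

Section Polynomials.
Context {R : realFieldType}.
Implicit Types p q : {poly R}.

(** A negative coefficient in degree [m] would be the leading one, by the size bound. Dividing [p]
    by it gives a monic polynomial, positive beyond some bound, so [p] would be negative there. *)
Lemma coef_ge0_of_horner_ge0 p (m : nat) :
  (size p <= m.+1)%N -> (forall t, 0 <= t -> 0 <= p.[t]) -> 0 <= p`_m.
Proof.
move=> sp p_ge0; rewrite leNgt; apply/negP => pm_lt0.
have sizep : size p = m.+1.
  apply/eqP; rewrite eqn_leq sp ltnNge; apply/negP => sm.
  by move: pm_lt0; rewrite nth_default ?ltxx.
have lead_p : lead_coef p = p`_m by rewrite lead_coefE sizep.
have monic_p : (p`_m)^-1 *: p \is monic.
  by rewrite monicE lead_coefZ lead_p mulVf // lt_eqF.
have [b bP] := monic_Cauchy_bound monic_p.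
have := bP (Num.max b 0); rewrite le_max lexx => /(_ isT).
rewrite hornerZ nmulr_rgt0 ?invr_lt0 // ltNge p_ge0 //.
by rewrite le_max lexx orbT.
Qed.

(** Upper bounds replace exact degrees because the top coefficients will be minors, which may
    vanish. *)
Lemma size_coefM_top p q (a b : nat) :
  (size p <= a.+1)%N -> (size q <= b.+1)%N ->
  (size (p * q)%R <= (a + b).+1)%N /\ (p * q)`_(a + b)%N = p`_a * q`_b.
Proof.
move=> sp sq; split.
  by apply: leq_trans (size_polyMleq _ _) _; move: sp sq; lia.
have lt_a : (a < (a + b).+1)%N by rewrite ltnS leq_addr.
rewrite coefM (bigD1 (Ordinal lt_a)) //= addKn big1 ?addr0 // => i ia.
have {ia} : (i : nat) != a by [].
(* Away from [i = a], either [i] exceeds the degree bound of [p], or [a + b - i] exceeds that of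
   [q]. *)
rewrite neq_ltn => /orP[ia|ai]; last first.
  by rewrite nth_default ?mul0r ?(leq_trans sp).
rewrite [q`_ _]nth_default ?mulr0 // (leq_trans sq) //.
by rewrite ltn_subRL ltn_add2r.
Qed.

Lemma size_coef_prod_top (J : finType) (F : J -> {poly R}) (m : J -> nat) :
  (forall j, size (F j) <= (m j).+1)%N ->
  (size (\prod_j F j)%R <= (\sum_j m j).+1)%N /\
  (\prod_j F j)`_(\sum_j m j)%N = \prod_j (F j)`_(m j).
Proof.
move=> sF; elim/big_rec3: _ => [|j x a p _ [sp <-]].
  by rewrite size_poly1 coefC.
exact: size_coefM_top.
Qed.

End Polynomials.

Section SortedEnumeration.
Context {n : nat}.
Implicit Types (X : {set 'I_n}) (u v : 'I_n).

Lemma sorted_enum_set X :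
  sorted (fun i j : 'I_n => (i < j)%N) (enum X).
Proof.
rewrite /enum_mem; apply: sorted_filter; first by move=> ? ? ?; apply: ltn_trans.
by rewrite -enumT -[sorted _ _](sorted_map (f := val) (e' := ltn)) val_enum_ord iota_ltn_sorted.
Qed.

Lemma consecutive_neq {u v} : consecutive u v -> u != v.
Proof. by apply: contraTneq => ->; rewrite /consecutive subrr. Qed.

Lemma consecutive_ltn {u v} (x : 'I_n) : consecutive u v ->
  x != u -> x != v -> (x < u)%N = (x < v)%N.
Proof.
move=> cuv; rewrite -!val_eqE /=.
move/eqP: cuv; lia.
Qed.

(** No integer lies strictly between [u] and [v], so putting [v] at the position of [u] keeps the
    list increasing. Hence no sign appears when row [u] of a minor is replaced by row [v]. *)
Lemma enum_replace X u v : consecutive u v -> u \in X -> v \notin X ->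
  enum (replace X u v) = [seq if x == u then v else x | x <- enum X].
Proof.
move=> cuv uX vX; have uv := consecutive_neq cuv.
apply: (@irr_sorted_eq _ (fun i j : 'I_n => (i < j)%N)).
- by move=> ? ? ?; apply: ltn_trans.
- by move=> ?; rewrite ltnn.
- exact: sorted_enum_set.
- rewrite sorted_map.
  apply: (sub_in_sorted (P := [in X])) (sorted_enum_set X).
    move=> x y xX yX /= xy.
    have xv : x != v by apply: contraNneq vX => <-.
    have yv : y != v by apply: contraNneq vX => <-.
    move: xy; case: (eqVneq x u) => [->|xu]; case: (eqVneq y u) => [->|yu] //.
    + by rewrite ltnn.
    + move: cuv uv yu yv; rewrite /consecutive -!val_eqE /=; lia.
    + by rewrite (consecutive_ltn x cuv xu xv).
  by apply/allP => x; rewrite mem_enum.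
- move=> x; rewrite mem_enum /replace uX vX /= !inE.
  apply/idP/mapP => [/orP[/eqP->|/andP[xu xX]]|[y]].
  + by exists u; rewrite ?mem_enum ?eqxx.
  + by exists x; rewrite ?mem_enum // (negPf xu).
  + rewrite mem_enum => yX ->; case: (eqVneq y u) => [|yu]; first by rewrite eqxx.
    by rewrite yu yX orbT.
Qed.

Lemma card_replace X u v : consecutive u v -> #|replace X u v| = #|X|.
Proof.
move=> cuv; have [/andP[uX vX]|/negPf uvX] := boolP ((u \in X) && (v \notin X)).
  by rewrite [LHS]cardE enum_replace // size_map -cardE.
by rewrite /replace uvX.
Qed.

End SortedEnumeration.

Section Minors.
Context {R : realType} {n : nat}.
Implicit Types (A : 'M[R]_n) (X Y : {set 'I_n}) (u v : 'I_n).

Lemma conform_mxsub {T : Type} {p q m k l : nat} (A : 'M[T]_(p, q))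
    (B : 'M_(m, k)) (f : 'I_m -> 'I_p) (g : 'I_l -> 'I_q) (e : k = l) :
  conform_mx B (mxsub f g A) = mxsub f (fun j => g (cast_ord e j)) A.
Proof.
case: _ / e g => g; rewrite conform_mx_id.
by apply/matrixP => i j; rewrite !mxE cast_ord_id.
Qed.

(** With [k] free, minors on different sets of the same cardinality become determinants of matrices
    of one type. *)
Lemma minorE A X Y (x0 : 'I_n) k : #|X| = k -> #|Y| = k ->
  minor A X Y = \det (\matrix_(i < k, j < k)
                        A (nth x0 (enum X) i) (nth x0 (enum Y) j)).
Proof.
move=> cX cY; rewrite /minor /submatrix; subst k.
rewrite (conform_mxsub _ _ _ _ (esym cY)).
congr (\det _); apply/matrixP => i j; rewrite !mxE.
by rewrite !(enum_val_nth x0).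
Qed.

Lemma minor_tr A X Y : #|X| = #|Y| -> minor A^T X Y = minor A Y X.
Proof.
(* [minorE] needs a default index, so the case [n = 0] is settled apart. *)
move=> cXY; have [x0 _|no_index] := pickP (mem [set: 'I_n]); last first.
  have empty (i : 'I_n) : False by have := no_index i; rewrite !inE.
  have -> : X = Y by apply/setP => i; case: (empty i).
  by congr minor; apply/matrixP => i; case: (empty i).
rewrite (minorE _ _ _ x0 #|Y|) // (minorE _ _ _ x0 #|Y|) // -det_tr.
by congr (\det _); apply/matrixP => i j; rewrite !mxE.
Qed.

Lemma totally_nonnegative_tr A :
  totally_nonnegative A -> totally_nonnegative A^T.
Proof. by move=> tnA X Y cXY; rewrite minor_tr //; apply: tnA. Qed.

(** This is [(1 + t E) A], with [E] the matrix unit at [(u, v)]. *)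
Definition add_row A u v (t : R) : 'M[R]_n :=
  \matrix_(i, j) (A i j + (t *+ (i == u)) * A v j).

(** The determinant is linear in the row coming from [u]; if [v] is also in [X], the extra term has
    two equal rows and vanishes. *)
Lemma minor_add_row A u v t X Y : consecutive u v -> #|X| = #|Y| ->
  minor (add_row A u v t) X Y =
  minor A X Y + (t *+ ((u \in X) && (v \notin X))) * minor A (replace X u v) Y.
Proof.
move=> cuv cXY; have uv := consecutive_neq cuv.
rewrite !(minorE _ _ _ u #|X|) ?card_replace //.
have sX : size (enum X) = #|X| by rewrite -cardE.
have uE (i : 'I_#|X|) :
    (nth u (enum X) i == u) = (u \in X) && (i == index u (enum X) :> nat).
  apply/eqP/andP => [ui|[uX /eqP->]]; last by rewrite nth_index ?mem_enum.
  split; first by rewrite -mem_enum -ui mem_nth ?sX.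
  by rewrite -{1}ui index_uniq ?sX ?enum_uniq.
have [uX|uX] := boolP (u \in X); last first.
  rewrite mul0r addr0; congr (\det _); apply/matrixP => i j.
  by rewrite !mxE uE (negPf uX) mul0r addr0.
have iX : (index u (enum X) < #|X|)%N by rewrite -sX index_mem mem_enum.
pose i0 := Ordinal iX.
(* [M id] gives the minor of [A] itself; sending [u] to [v] puts row [v] of [A] in place of row
   [u]. *)
pose M (f : 'I_n -> 'I_n) := \matrix_(i < #|X|, j < #|X|)
  A (f (nth u (enum X) i)) (nth u (enum Y) j).
have uE' (i : 'I_#|X|) : (nth u (enum X) i == u) = (i == i0) by rewrite uE uX.
rewrite (@determinant_multilinear _ _ _
   (M id) (M (fun x => if x == u then v else x)) i0 1 t); first last.
- apply/matrixP => i j; rewrite !mxE uE' eq_sym (negPf (neq_lift _ _)).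
  by rewrite mul0r addr0.
- apply/matrixP => i j; rewrite !mxE uE' eq_sym (negPf (neq_lift _ _)).
  by rewrite mul0r addr0.
- by apply/rowP => j; rewrite !mxE uE' eqxx mul1r.
rewrite mul1r; congr (_ + _).
have [vX|vX] := boolP (v \in X).
  have jX : (index v (enum X) < #|X|)%N by rewrite -sX index_mem mem_enum.
  rewrite (@determinant_alternate _ _ _ i0 (Ordinal jX)) ?mulr0 ?mul0r //.
    apply: contra_neq uv => /(congr1 val) /= E.
    by rewrite -[u](nth_index u (s := enum X)) ?mem_enum // E nth_index
               ?mem_enum.
  by move=> j; rewrite !mxE uE' eqxx /= !nth_index ?mem_enum // eq_sym (negPf uv).
congr (_ * \det _); apply/matrixP => i j.
by rewrite !mxE enum_replace // (nth_map u) ?sX.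
Qed.

Lemma totally_nonnegative_add_row A u v t : consecutive u v -> 0 <= t ->
  totally_nonnegative A -> totally_nonnegative (add_row A u v t).
Proof.
move=> cuv t0 tnA X Y cXY; rewrite minor_add_row // addr_ge0 ?tnA //.
by rewrite mulr_ge0 ?mulrn_wge0 ?tnA ?card_replace.
Qed.

End Minors.

(** Isolating the row version allows its reuse with [rows] and [cols] exchanged. *)
Lemma max_replaced_rows_ge0 (R : realType) (n : nat)
    (I : finType) (gamma : I -> nat)
    (rows cols : forall i : I, 'I_(gamma i) -> {set 'I_n})
    (card_rows_cols : forall (i : I) (j : 'I_(gamma i)),
       #|rows i j| = #|cols i j|)
    (lambda : I -> R) :
  (forall A : 'M[R]_n, totally_nonnegative A ->
     0 <= \sum_(i : I) lambda i *
            \prod_(j < gamma i) minor A (rows i j) (cols i j)) ->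
  forall u v : 'I_n, consecutive u v ->
  forall A : 'M[R]_n, totally_nonnegative A ->
    0 <= \sum_(i in max_replaced rows u v) lambda i *
           \prod_(j < gamma i) minor A (replace (rows i j) u v) (cols i j).
Proof.
move=> H u v cuv A tnA.
set m := \max_(i : I) #|replaced rows u v i|.
(* By [minor_add_row], the value of [F i j] at [t >= 0] is the minor of [add_row A u v t] on the
   same sets. *)
pose F i j : {poly R} := (minor A (rows i j) (cols i j))%:P +
  (minor A (replace (rows i j) u v) (cols i j) *+ (j \in replaced rows u v i))
    *: 'X.
pose P := \sum_(i : I) lambda i *: \prod_(j < gamma i) F i j.
(* Each factor has degree at most 1 if [j] is in [replaced rows u v i] and at most 0 otherwise. In
   the latter case [replace] fixes the row set, so the constant coefficient is already the wanted
   minor. *)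
have top i : (size (\prod_(j < gamma i) F i j)%R <= #|replaced rows u v i|.+1)%N /\
    (\prod_(j < gamma i) F i j)`_#|replaced rows u v i| =
    \prod_(j < gamma i) minor A (replace (rows i j) u v) (cols i j).
  have -> : #|replaced rows u v i|
            = (\sum_(j < gamma i) (j \in replaced rows u v i))%N.
    by rewrite -sum1_card big_mkcond; apply: eq_bigr => j _; case: ifP.
  have [j|-> ->] := @size_coef_prod_top _ _ (F i)
                      (fun j => (j \in replaced rows u v i)).
    rewrite /F; case: (j \in _) => /=.
      rewrite (leq_trans (size_polyD _ _)) // geq_max.
      rewrite (leq_trans (size_polyC_leq1 _)) //=.
      by rewrite (leq_trans (size_scale_leq _ _)) // size_polyX.
    by rewrite scale0r addr0 size_polyC_leq1.
  split => //; apply: eq_bigr => j _.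
  rewrite /F coefD coefC coefZ coefX inE /replace.
  by case: (_ && _); rewrite ?mulr1 ?add0r // mul0r addr0.
(* An index outside [max_replaced rows u v] has a product of degree below [m], so it adds nothing to
   this coefficient. *)
have -> : \sum_(i in max_replaced rows u v) lambda i *
    \prod_(j < gamma i) minor A (replace (rows i j) u v) (cols i j) = P`_m.
  rewrite /P coef_sum big_mkcond; apply: eq_bigr => i _.
  have [si ci] := top i.
  rewrite inE coefZ -/m; case: eqVneq => [<-|im]; first by rewrite ci.
  rewrite nth_default ?mulr0 // (leq_trans si) // ltn_neqAle im /=.
  exact: (leq_bigmax_cond (F := fun i => #|replaced rows u v i|)).
apply: coef_ge0_of_horner_ge0.
  apply: (leq_trans (size_sum _ _ _)); apply/bigmax_leqP => i _.
  apply: (leq_trans (size_scale_leq _ _)); apply: (leq_trans (top i).1).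
  by rewrite ltnS (leq_bigmax_cond (F := fun i => #|replaced rows u v i|)).
(* The value of [P] at [t] is the sum in the hypothesis, taken at the totally nonnegative matrix
   [add_row A u v t]. *)
move=> t t0.
have := H _ (totally_nonnegative_add_row A u v t cuv t0 tnA).
congr (0 <= _); rewrite /P horner_sum; apply: eq_bigr => i _.
rewrite hornerZ horner_prod; congr (_ * _); apply: eq_bigr => j _.
rewrite minor_add_row // hornerD hornerC hornerZ hornerX inE.
by case: (_ && _); rewrite ?mulr0n ?mul0r // mulr1n mulrC.
Qed.

Theorem lemmaD (R : realType) (n : nat) (n_gt0 : (0 < n)%N)
    (I : finType) (I_gt0 : (0 < #|I|)%N)
    (gamma : I -> nat) (gamma_gt0 : forall i : I, (0 < gamma i)%N)
    (rows cols : forall i : I, 'I_(gamma i) -> {set 'I_n})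
    (card_rows_cols : forall (i : I) (j : 'I_(gamma i)),
       #|rows i j| = #|cols i j|)
    (lambda : I -> R) :
  (forall A : 'M[R]_n, totally_nonnegative A ->
     0 <= \sum_(i : I) lambda i *
            \prod_(j < gamma i) minor A (rows i j) (cols i j)) ->
  (forall u v : 'I_n, consecutive u v ->
   forall A : 'M[R]_n, totally_nonnegative A ->
     0 <= \sum_(i in max_replaced rows u v) lambda i *
            \prod_(j < gamma i) minor A (replace (rows i j) u v) (cols i j))
  /\
  (forall u v : 'I_n, consecutive u v ->
   forall A : 'M[R]_n, totally_nonnegative A ->
     0 <= \sum_(i in max_replaced cols u v) lambda i *
            \prod_(j < gamma i) minor A (rows i j) (replace (cols i j) u v)).
Proof.
move=> H; split; first exact: max_replaced_rows_ge0.
move=> u v cuv A tnA.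
(* Evaluating the hypothesis at the transpose of [B] exchanges the two families; the row version is
   then applied at the transpose of [A]. *)
have Htr (B : 'M[R]_n) : totally_nonnegative B -> 0 <= \sum_(i : I) lambda i *
    \prod_(j < gamma i) minor B (cols i j) (rows i j).
  move=> /totally_nonnegative_tr /H; congr (0 <= _).
  apply: eq_bigr => i _; congr (_ * _); apply: eq_bigr => j _.
  by rewrite minor_tr.
have card_cols_rows i j : #|cols i j| = #|rows i j| by [].
have := max_replaced_rows_ge0 _ _ _ _ _ _ card_cols_rows _ Htr u v cuv _
  (totally_nonnegative_tr _ tnA).
congr (0 <= _); apply: eq_bigr => i _; congr (_ * _); apply: eq_bigr => j _.
by rewrite minor_tr // card_replace.
Qed.
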